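(* Let $\mu$ be an isotropic log-concave probability measure on $\mathbb{R}$ (i.e. with mean $0$ and variance $1$). Then $\Gamma(\mu)\leq 2$. Moreover, the bound is sharp: if $\mu$ is the law of $Y-1$ where $Y$ is exponentially distributed with parameter $1$ (density $e^{-(x+1)}\mathbf{1}_{\{x\geq -1\}}$), then $\mu$ is isotropic log-concave and $\Gamma(\mu)=2$.
   Context: A probability measure on $\mathbb{R}$ is log-concave if it has a density $f$ with $\ln f$ concave. For an interval $I=[a,b]$, $\mu^+(\partial I)=\liminf_{\epsilon\to0^+}\frac{\mu([a-\epsilon,b+\epsilon])-\mu([a,b])}{\epsilon}$, and $\Gamma(\mu)=\sup\{\mu^+(\partial I): I=[a,b]\subset\mathbb{R},\ a<b\}$. *)

(* Defs.v *)
From HB Require Import structures.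
From mathcomp Require Import all_boot all_order all_algebra.
From mathcomp Require Import all_classical all_reals all_analysis.
Set Implicit Arguments. Unset Strict Implicit. Unset Printing Implicit Defensive.
Import Order.TTheory GRing.Theory Num.Theory.
Import numFieldNormedType.Exports.
Local Open Scope classical_set_scope.
Local Open Scope ring_scope.
Local Open Scope ereal_scope.

Section Defs.
Variable R : realType.

Definition lnE (f : R -> R) (x : R) : \bar R :=
  if (0 < f x)%R then (ln (f x))%:E else -oo.

Definition log_concave_fun (f : R -> R) : Prop :=
  forall x y t : R, (0 < t < 1)%R ->
    t%:E * lnE f x + (1 - t)%:E * lnE f y <= lnE f (t * x + (1 - t) * y)%R.

Definition prob_density (f : R -> R) : Prop :=
  measurable_fun [set: R] f /\ (forall x, 0 <= f x)%R /\
  \int[lebesgue_measure]_x (f x)%:E = 1.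

Definition mu_of (f : R -> R) (A : set R) : \bar R :=
  \int[lebesgue_measure]_(x in A) (f x)%:E.

Definition log_concave_density (f : R -> R) : Prop :=
  prob_density f /\ log_concave_fun f.

Definition isotropic_density (f : R -> R) : Prop :=
  \int[lebesgue_measure]_x (x * f x)%:E = 0 /\
  \int[lebesgue_measure]_x (x ^+ 2 * f x)%:E = 1.

Definition boundary_measure (f : R -> R) (a b : R) : \bar R :=
  limf_einf (fun eps : R =>
     (mu_of f `[(a - eps)%R, (b + eps)%R]%classic - mu_of f `[a, b]%classic)
       * (eps^-1)%:E) (0%R)^'+.

Definition Gamma (f : R -> R) : \bar R :=
  ereal_sup [set boundary_measure f ab.1 ab.2 | ab in [set ab : R * R | (ab.1 < ab.2)%R]].

Definition shifted_exp_density (x : R) : R :=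
  (if -1 <= x then expR (- (x + 1)) else 0)%R.

End Defs.

(* Main.v *)
(* An isotropic log-concave density f is bounded by 1, which bounds each of the
   two boundary strips of width e by e.  To see this, fix c with M = f(c) > 0 and
   let g(x) = f(c + x), x >= 0.  Log-concavity gives g(0) g(x + y) <= g(x) g(y);
   integrating this against y^n, Tonelli's theorem yields
     M I_(n+1) <= (n + 1) I_n I_0,   where I_n is the n-th moment of g on [0, +oo[.
   The same holds on the left of c.  If p, q are the masses on the two sides and
   A, B the absolute first moments about c, then M A <= p^2, M B <= q^2 and
   1 = Var <= 2 (p A + q B) / M - (A - B)^2 <= (1 - 2 p q) / M^2, so M <= 1.
   For the exponential density g is multiplicative, so the moment inequality is
   an equality and computes the moments; f is close to 1 on intervals just to
   the right of -1, which gives the lower bound on Gamma. *)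

Require Import Defs.
From HB Require Import structures.
From mathcomp Require Import all_boot all_order all_algebra.
From mathcomp Require Import all_classical all_reals all_analysis.
From mathcomp Require Import ring lra measurable_realfun.
Import Order.TTheory GRing.Theory Num.Theory.
Import numFieldNormedType.Exports.
Local Open Scope classical_set_scope.
Local Open Scope ring_scope.
Local Open Scope ereal_scope.

(** * Change of variables under translation and reflection *)

(** By uniqueness of Lebesgue measure: the pushforward gives half-open intervals their length. *)
Lemma lebesgue_measure_shift {R : realType} (c : R) (A : set R) :
  measurable A ->
  pushforward lebesgue_measure (+%R c : _ -> measurableTypeR R) A =
  lebesgue_measure A.
Proof.
move=> mA; apply/esym/lebesgue_measure_unique => //=.
  exact: measurable_funD.
move=> mc _ [[a b]] _ <-.
rewrite /pushforward (_ : _ @^-1` _ = `](a - c)%R, (b - c)%R]%classic).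
  rewrite !lebesgue_measure_itv/= !lte_fin ltrD2r; case: ifP => // _.
  by rewrite -!EFinD; congr EFin; ring.
by apply/seteqP; split=> x /=; rewrite !in_itv/= => /andP[? ?]; apply/andP; split; lra.
Qed.

Lemma ge0_integral_shift {R : realType} (c : R) (D : set R) (f : R -> \bar R) :
  measurable D -> measurable_fun [set: R] f -> (forall x, 0 <= f x) ->
  \int[lebesgue_measure]_(x in D) f x =
  \int[lebesgue_measure]_(x in +%R c @^-1` D) f (c + x)%R.
Proof.
move=> mD mf f0.
have mc : measurable_fun [set: measurableTypeR R]
    (+%R c : measurableTypeR R -> measurableTypeR R).
  exact: measurable_funD.
rewrite -(@ge0_integral_pushforward _ _ _ _ _ _ mc lebesgue_measure D f)//.
  by apply: eq_measure_integral => // A mA AD; exact/esym/lebesgue_measure_shift.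
exact: measurable_funS mf.
Qed.

Lemma ge0_integral_opp {R : realType} (D : set R) (f : R -> \bar R) :
  measurable D -> measurable_fun [set: R] f -> (forall x, 0 <= f x) ->
  \int[lebesgue_measure]_(x in D) f x =
  \int[lebesgue_measure]_(x in -%R @^-1` D) f (- x)%R.
Proof.
move=> mD mf f0.
have mN : measurable_fun [set: measurableTypeR R]
    (-%R : measurableTypeR R -> measurableTypeR R) by [].
rewrite -(@ge0_integral_pushforward _ _ _ _ _ _ mN lebesgue_measure D f)//.
  by apply: eq_measure_integral => // A mA AD; exact/esym/lebesgue_measureN.
exact: measurable_funS mf.
Qed.

(** * Moments on the half-line and their recurrence *)

Lemma integral_exprn {R : realType} (n : nat) (w : R) : (0 <= w)%R ->
  \int[lebesgue_measure]_(y in `[0%R, w]) (y ^+ n)%:E =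
  (w ^+ n.+1 / n.+1%:R)%:E.
Proof.
(* The fundamental theorem of calculus is applied on a nondegenerate interval, so [w = 0] is treated
   apart. *)
rewrite le_eqVlt => /predU1P[<-|w0].
  by rewrite set_itv1 integral_set1 exprS !mul0r.
pose F (y : R) : R := ((n.+1%:R)^-1 * y ^+ n.+1)%R.
have dF (x : R) : is_derive x 1%R F (x ^+ n)%R.
  have dX : is_derive x 1%R ((id : R -> R) ^+ n.+1)%R (n.+1%:R * x ^+ n)%R.
    by apply: is_derive_eq; rewrite /GRing.scale/= mulr1 mulr_natl.
  rewrite (_ : F = n.+1%:R^-1 \*: ((id : R -> R) ^+ n.+1)%R); last first.
    by apply/funext => y; rewrite /F/= exprfctE.
  by apply: is_derive_eq; rewrite /GRing.scale/= mulKf.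
have cF : continuous F.
  by move=> x; apply/differentiable_continuous/derivable1_diffP; case: (dF x).
rewrite (@continuous_FTC2 _ _ F)//.
- by rewrite /F expr0n/= mulr0 sube0 mulrC.
- exact/continuous_subspaceT/exprn_continuous.
- split.
  + by move=> x _; case: (dF x).
  + exact/cvg_at_right_filter/cF.
  + exact/cvg_at_left_filter/cF.
- by move=> x _; rewrite derive1E; apply: derive_val.
Qed.

(** Valued in the extended reals, so that the moment inequalities can be stated before finiteness is
    known. *)
Definition half_moment {R : realType} (g : R -> R) (n : nat) : \bar R :=
  \int[lebesgue_measure]_(x in `[0%R, +oo[) (x ^+ n * g x)%:E.

(* Both sides are the integral of [(n+1) y^n g(w)] over [0 <= y <= w]. *)
Lemma half_moment_succE {R : realType} (g : R -> R) (n : nat) :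
  measurable_fun [set: R] g -> (forall x, 0 <= g x)%R ->
  half_moment g n.+1 =
  n.+1%:R%:E * \int[lebesgue_measure]_(y in `[0%R, +oo[)
    ((y ^+ n)%:E * \int[lebesgue_measure]_(x in `[0%R, +oo[) (g (y + x))%:E).
Proof.
move=> mg g0.
(* The constraint [0 <= y <= w] is built into the integrand, so that both iterated integrals run
   over the whole line. *)
pose F (z : measurableTypeR R * measurableTypeR R) : \bar R :=
  (if (0 <= z.1)%R && (z.1 <= z.2)%R then z.1 ^+ n * g z.2 else 0)%:E.
have F0 z : 0 <= F z.
  rewrite /F lee_fin; case: ifP => // /andP[z0 _].
  by rewrite mulr_ge0// exprn_ge0.
have mF : measurable_fun setT F.
  apply/measurable_EFinP/measurable_fun_ifT => //.
    by apply: measurable_and; apply: measurable_fun_ler.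
  apply: measurable_funM; first exact: measurable_funX.
  exact: measurableT_comp.
(* Integrating in [y] first gives [w ^+ n.+1 / n.+1 * g w]. *)
have L w : ((fun w => (w ^+ n.+1 * g w)%:E) \_ `[0%R, +oo[) w =
    n.+1%:R%:E * \int[lebesgue_measure]_y F (y, w).
  rewrite patchE; case: ifPn; rewrite mem_setE in_itv/= andbT => w0.
    rewrite (_ : (fun y : measurableTypeR R => F (y, w)) =
      ((fun y => (g w)%:E * (y ^+ n)%:E) \_ `[0%R, w])); last first.
      apply/funext => y; rewrite patchE mem_setE in_itv /F/=.
      by case: ifP; rewrite // mulrC.
    rewrite -integral_mkcond ge0_integralZl ?lee_fin//; last first.
    - by move=> y /=; rewrite in_itv/= lee_fin => /andP[y0 _]; rewrite exprn_ge0.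
    - by apply/measurable_EFinP/measurable_funTS; exact: measurable_funX.
    by rewrite integral_exprn// -!EFinM; congr EFin; field.
  rewrite integral0_eq ?mule0// => y _; rewrite /F/=; case: ifP => // /andP[y0 yw].
  by rewrite (le_trans y0 yw) in w0.
rewrite /half_moment [LHS]integral_mkcond; under eq_integral do rewrite L.
rewrite ge0_integralZl ?lee_fin//; last 2 first.
- exact: measurable_fun_fubini_tonelli_G.
- by move=> w _; apply: integral_ge0.
(* In the other order, [w] runs over [[y, +oo[], which the substitution [w = y + x] moves to [[0,
   +oo[]. *)
congr (_ * _); rewrite -fubini_tonelli//.
rewrite [RHS]integral_mkcond; apply: eq_integral => y _.
rewrite patchE; case: ifPn; rewrite mem_setE in_itv/= andbT => y0.
  transitivity (\int[lebesgue_measure]_(w in `[y, +oo[) ((y ^+ n)%:E * (g w)%:E)).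
    rewrite [RHS]integral_mkcond; apply: eq_integral => w _.
    rewrite patchE /F/= y0/=.
    by rewrite mem_setE in_itv/= andbT; case: ifP.
  rewrite ge0_integralZl ?lee_fin//; last 3 first.
  - exact/measurable_EFinP/measurable_funTS.
  - by move=> w _; rewrite lee_fin.
  - by rewrite exprn_ge0.
  congr (_ * _).
  rewrite (@ge0_integral_shift _ y)//; last first.
    exact/measurable_EFinP.
  congr integral.
  by apply/seteqP; split => x /=; rewrite !in_itv/= !andbT; lra.
rewrite integral0_eq// => w _; rewrite /F/=; case: ifP => // /andP[y0' _].
by rewrite y0' in y0.
Qed.


Lemma half_moment_ge0 {R : realType} (g : R -> R) (n : nat) :
  (forall x, 0 <= g x)%R -> 0 <= half_moment g n.
Proof.
move=> g0; apply: integral_ge0 => x /=; rewrite in_itv/= andbT => x0.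
by rewrite lee_fin mulr_ge0// exprn_ge0.
Qed.

Lemma half_moment0 {R : realType} (g : R -> R) :
  half_moment g 0 = \int[lebesgue_measure]_(x in `[0%R, +oo[) (g x)%:E.
Proof. by apply: eq_integral => x _; rewrite expr0 mul1r. Qed.

(** The tail is a partial integral of a nonnegative jointly measurable function, hence measurable by
    Tonelli; this allows it to be integrated against [y ^+ n]. *)
Lemma measurable_fun_tail {R : realType} (g : R -> R) :
  measurable_fun [set: R] g -> (forall x, 0 <= g x)%R ->
  measurable_fun [set: R] (fun y : R =>
    \int[lebesgue_measure]_(x in `[0%R, +oo[) (g (y + x))%:E).
Proof.
move=> mg g0.
pose F (z : measurableTypeR R * measurableTypeR R) : \bar R :=
  (if (0 <= z.2)%R then g (z.1 + z.2)%R else 0)%:E.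
have F0 z : 0 <= F z by rewrite /F lee_fin; case: ifP.
have mF : measurable_fun setT F.
  apply/measurable_EFinP/measurable_fun_ifT => //.
    exact: measurable_fun_ler.
  by apply: measurableT_comp => //; exact: measurable_funD.
apply: eq_measurable_fun
  (@measurable_fun_fubini_tonelli_F _ _ _ _ _ lebesgue_measure F mF F0).
move=> y _; rewrite [RHS]integral_mkcond; apply: eq_integral => x _.
by rewrite patchE mem_setE in_itv/= andbT /F/=; case: ifP.
Qed.

(** Integrating the hypothesis in [x] bounds [g 0] times the tail at [y] by [g y] times the total
    mass; integrating this against [y ^+ n] gives the claim by [half_moment_succE]. *)
Lemma half_moment_succ_le {R : realType} (g : R -> R) (n : nat) :
  measurable_fun [set: R] g -> (forall x, 0 <= g x)%R ->
  (forall x y, 0 <= x -> 0 <= y -> g 0 * g (x + y) <= g x * g y)%R ->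
  (g 0%R)%:E * half_moment g n.+1 <=
  n.+1%:R%:E * (half_moment g n * half_moment g 0).
Proof.
move=> mg g0 glc.
rewrite half_moment_succE// muleCA lee_wpmul2l ?lee_fin//.
have mT := measurable_fun_tail _ mg g0.
have mXn : measurable_fun [set: R] (fun y : R => (y ^+ n)%:E).
  by apply/measurable_EFinP; exact: measurable_funX.
have T0 y : 0 <= \int[lebesgue_measure]_(x in `[0%R, +oo[) (g (y + x))%:E.
  by apply: integral_ge0 => x _; rewrite lee_fin.
rewrite -ge0_integralZl ?lee_fin//; last 2 first.
- exact/measurable_funTS/emeasurable_funM.
- move=> y /=; rewrite in_itv/= andbT => y0.
  by rewrite mule_ge0// lee_fin exprn_ge0.
rewrite /half_moment -ge0_integralZr//; last 3 first.
- apply/measurable_EFinP/measurable_funTS.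
  by apply: measurable_funM => //; exact: measurable_funX.
- move=> y /=; rewrite in_itv/= andbT => y0.
  by rewrite lee_fin mulr_ge0// exprn_ge0.
- exact: half_moment_ge0.
apply: ge0_le_integral => //.
- move=> y /=; rewrite in_itv/= andbT => y0.
  by rewrite !mule_ge0// lee_fin// exprn_ge0.
- apply/measurable_funTS/emeasurable_funM => //; exact: emeasurable_funM.
- apply/measurable_funTS/emeasurable_funM => //.
  by apply/measurable_EFinP/measurable_funM => //; exact: measurable_funX.
move=> y /=; rewrite in_itv/= andbT => y0.
rewrite muleCA EFinM -muleA lee_wpmul2l ?lee_fin ?exprn_ge0//.
rewrite -/(half_moment g 0) half_moment0 -!ge0_integralZl ?lee_fin//; last 4 first.
- exact/measurable_EFinP/measurable_funTS.
- by move=> x _; rewrite lee_fin.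
- apply/measurable_EFinP/measurable_funTS/measurableT_comp => //.
  exact: measurable_funD.
- by move=> x _; rewrite lee_fin.
apply: ge0_le_integral => //.
- by move=> x _; rewrite lee_fin mulr_ge0.
- apply/measurable_EFinP/measurable_funTS/measurable_funM => //.
  by apply: measurableT_comp => //; exact: measurable_funD.
- exact/measurable_EFinP/measurable_funTS/measurable_funM.
- by move=> x /=; rewrite in_itv/= andbT => x0; rewrite lee_fin glc.
Qed.

(** The tail at [y] is exactly [expR (- y)] times the total mass, since the exponential is
    multiplicative. *)
Lemma half_moment_expRN_succ {R : realType} (n : nat) :
  half_moment (fun x : R => expR (- x)) n.+1 =
  n.+1%:R%:E * (half_moment (fun x : R => expR (- x)) n *
                half_moment (fun x : R => expR (- x)) 0).
Proof.
pose g (x : R) := expR (- x).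
have mg : measurable_fun [set: R] g by apply: measurableT_comp.
have g0 x : (0 <= g x)%R by exact: expR_ge0.
rewrite half_moment_succE//; congr (_ * _).
rewrite /half_moment -ge0_integralZr//; last 3 first.
- apply/measurable_EFinP/measurable_funTS.
  by apply: measurable_funM => //; exact: measurable_funX.
- move=> y /=; rewrite in_itv/= andbT => y0.
  by rewrite lee_fin mulr_ge0// exprn_ge0.
- exact: half_moment_ge0.
apply: eq_integral => y _; rewrite EFinM -muleA; congr (_ * _).
rewrite -/(half_moment g 0) half_moment0 -ge0_integralZl ?lee_fin//; last 2 first.
- exact/measurable_EFinP/measurable_funTS.
- by move=> x _; rewrite lee_fin.
by apply: eq_integral => x _; rewrite opprD expRD.
Qed.

Lemma half_moment_expRN0 {R : realType} :
  half_moment (fun x : R => expR (- x)) 0 = 1.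
Proof.
rewrite half_moment0 -(@integral_exponential_pdf R 1)//.
rewrite [LHS]integral_mkcond; apply: eq_integral => x _.
rewrite /exponential_pdf !patchE.
by case: ifP => //; rewrite mul1r mulN1r.
Qed.

(** * Folding the line at a point, and log-concavity along rays *)

(** Both sides of [c] are parametrized by the distance to [c], so that integrals over the line
    become sums of half-line integrals. *)
Lemma ge0_integral_split_at {R : realType} (c : R) (f : R -> \bar R) :
  measurable_fun [set: R] f -> (forall x, 0 <= f x) ->
  \int[lebesgue_measure]_x f x =
  \int[lebesgue_measure]_(x in `[0%R, +oo[) f (c + x)%R +
  \int[lebesgue_measure]_(x in `[0%R, +oo[) f (c - x)%R.
Proof.
move=> mf f0; rewrite (@ge0_integral_shift _ c)// preimage_setT.
have mfc : measurable_fun [set: R] (fun x => f (c + x)%R).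
  by apply: measurableT_comp => //; exact: measurable_funD.
have -> : [set: R] = `]-oo, 0%R[ `|` `[0%R, +oo[.
  by apply/seteqP; split=> x //= _; rewrite !in_itv/= andbT; case: (ltP x 0%R); [left|right].
rewrite ge0_integral_setU//=; last 2 first.
- exact: measurable_funTS.
- apply/disj_setPS => x /=; rewrite !in_itv/= andbT => -[? ?]; lra.
rewrite addeC; congr (_ + _).
rewrite ge0_integral_opp//.
have -> : (-%R @^-1` `]-oo, 0%R[%classic = `]0%R, +oo[%classic :> set R).
  by apply/seteqP; split => x /=; rewrite !in_itv/= ?andbT; lra.
(* The point 0 is a null set and may be counted on both sides. *)
rewrite integral_itv_obnd_cbnd//; apply: measurable_funTS.
by apply: (measurableT_comp mfc).
Qed.

(** Concavity of the logarithm is used with weights [t] and [1 - t] and then with the weights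
    swapped; in the sum, [ln (f a)] and [ln (f b)] each have coefficient 1. The product form also
    covers zeros of [f]. *)
Lemma log_concave_mul_le {R : realType} (f : R -> R) (a b t : R) :
  (forall x, 0 <= f x)%R -> log_concave_fun f -> (0 <= t <= 1)%R ->
  (f a * f b <= f (t * a + (1 - t) * b) * f ((1 - t) * a + t * b))%R.
Proof.
move=> f0 lc /andP[]; rewrite le_eqVlt => /predU1P[<- _|t0].
  by rewrite !mul0r subr0 !mul1r add0r addr0 mulrC.
rewrite le_eqVlt => /predU1P[->|t1].
  by rewrite subrr !mul0r !mul1r addr0 add0r.
have := f0 a; rewrite le_eqVlt => /predU1P[<-|fa]; first by rewrite mul0r mulr_ge0.
have := f0 b; rewrite le_eqVlt => /predU1P[<-|fb]; first by rewrite mulr0 mulr_ge0.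
have t01 : (0 < t < 1)%R by rewrite t0.
have s01 : (0 < 1 - t < 1)%R by apply/andP; split; lra.
have := lc a b _ t01; have := lc a b _ s01.
rewrite opprB addrCA subrr addr0 /lnE fa fb -!EFinM -!EFinD.
(* If [f] vanished at an intermediate point, [lnE] would be [-oo] there and could not bound a finite
   number. *)
case: ifP => // fs; case: ifP => // ft; rewrite !lee_fin => hs ht.
rewrite -ler_ln ?posrE ?mulr_gt0// !lnM ?posrE//.
by lra.
Qed.

(** The two inner points are convex combinations of [c] and [c + s * (x + y)] with swapped weights
    [y / (x + y)] and [x / (x + y)]. The sign [s] is 1 or -1 according to the side of [c]. *)
Lemma log_concave_half_line {R : realType} (f : R -> R) (c s x y : R) :
  (forall x, 0 <= f x)%R -> log_concave_fun f -> (0 <= x)%R -> (0 <= y)%R ->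
  (f c * f (c + s * (x + y)) <= f (c + s * x) * f (c + s * y))%R.
Proof.
move=> f0 lc x0 y0.
have := addr_ge0 x0 y0; rewrite le_eqVlt => /predU1P[xy0|xy0].
  have [-> ->] : x = 0%R /\ y = 0%R by split; lra.
  by rewrite addr0 mulr0 addr0.
have xy : (x + y != 0)%R by rewrite gt_eqF.
have t01 : (0 <= y / (x + y) <= 1)%R.
  apply/andP; split; first exact: divr_ge0 (ltW xy0).
  by rewrite ler_pdivrMr// mul1r lerDr.
have := @log_concave_mul_le _ f c (c + s * (x + y))%R _ f0 lc t01.
have -> : (y / (x + y) * c + (1 - y / (x + y)) * (c + s * (x + y)) = c + s * x)%R.
  by field.
by have -> : ((1 - y / (x + y)) * c + y / (x + y) * (c + s * (x + y)) = c + s * y)%R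
  by field.
Qed.

(** * From mean and variance to a bound on the density *)

(* [M ^+ 2 <= 1 - 2pq - 2q(p^2 - MA) - 2p(q^2 - MB) - (...)^2], where [A - B] is
   the mean and [E + F] the second moment, both taken about [c]. *)
Lemma variance_density_bound {R : realType} (M p q A B E F c : R) :
  (0 < M)%R -> (0 <= p)%R -> (0 <= q)%R -> (p + q = 1)%R ->
  (M * A <= p * p)%R -> (M * B <= q * q)%R ->
  (M * E <= 2 * (A * p))%R -> (M * F <= 2 * (B * q))%R ->
  (A - B = - c)%R -> (E + F = 1 + c ^+ 2)%R -> (M <= 1)%R.
Proof.
move=> M0 p0 q0 pq hA hB hE hF hc hEF.
have hs : (0 <= p * p - M * A)%R by rewrite subr_ge0.
have ht : (0 <= q * q - M * B)%R by rewrite subr_ge0.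
pose s := (p * p - M * A)%R; pose t := (q * q - M * B)%R.
have : (M ^+ 2 * (1 + c ^+ 2) <= 2 * (M * A * p + M * B * q))%R.
  rewrite -hEF; have := ler_wpM2l (ltW M0) hE; have := ler_wpM2l (ltW M0) hF.
  by lra.
have -> : c = (B - A)%R by lra.
have qE : q = (1 - p)%R by lra.
(* With [p + q = 1], the terms free of [s] and [t] are [2 (p^3 + q^3) = 2 - 6pq] and
   [(q^2 - p^2)^2 = 1 - 4pq], whose difference is [1 - 2pq]. *)
have key : (2 * (M * A * p + M * B * q) - (M * (B - A)) ^+ 2 =
  1 - 2 * (p * q) - 2 * (q * s) - 2 * (p * t) - (s - t) ^+ 2)%R.
  by rewrite /s /t qE; ring.
have h1 := mulr_ge0 p0 q0; have h2 := mulr_ge0 q0 hs; have h3 := mulr_ge0 p0 ht.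
have h4 := sqr_ge0 (s - t)%R.
rewrite -/s in h2; rewrite -/t in h3 => h.
have : (M ^+ 2 <= 1)%R by nra.
by rewrite expr_le1// ltW.
Qed.

(** For [n <= 2], [|x|^n <= 1 + x^2], and both [f] and [x^2 f] have integral 1. Integrability is
    what lets signed integrals be expanded linearly below. *)
Lemma isotropic_integrable {R : realType} (f : R -> R) (n : nat) :
  prob_density f -> isotropic_density f -> (n <= 2)%N ->
  lebesgue_measure.-integrable [set: R] (fun x => (x ^+ n * f x)%:E).
Proof.
move=> [mf [f0 f1]] [_ f2] n2.
have mX k : measurable_fun [set: R] (fun x => (x ^+ k * f x)%:E).
  by apply/measurable_EFinP/measurable_funM => //; exact: measurable_funX.
apply/integrableP; split; first exact: mX.
apply: (@le_lt_trans _ _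
    (\int[lebesgue_measure]_x ((f x)%:E + (x ^+ 2 * f x)%:E))).
  apply: ge0_le_integral => //.
  - by apply: measurableT_comp => //; exact: mX.
  - by apply: emeasurable_funD; [exact/measurable_EFinP|exact: mX].
  move=> x _; rewrite abse_EFin -EFinD lee_fin normrM (ger0_norm (f0 x)).
  rewrite -[X in (_ <= X + _)%R]mul1r -mulrDl ler_wpM2r//.
  move: n n2 => [|[|[|//]]] _; rewrite ?expr0 ?expr1 ?normr1.
  - by rewrite lerDl sqr_ge0.
  - by rewrite ler_norml; apply/andP; split; nra.
  - by rewrite ger0_norm ?sqr_ge0// lerDr.
rewrite ge0_integralD//; last 4 first.
- by move=> x _; rewrite lee_fin.
- exact/measurable_EFinP.
- by move=> x _; rewrite lee_fin mulr_ge0// sqr_ge0.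
- exact: mX.
by rewrite f1 f2 ltry.
Qed.

Lemma isotropic_first_moment {R : realType} (f : R -> R) (c : R) :
  prob_density f -> isotropic_density f ->
  \int[lebesgue_measure]_x ((x - c) * f x)%:E = (- c)%:E.
Proof.
move=> df isof; have [mf [f0 f1]] := df; have [m1 m2] := isof.
have i0 := isotropic_integrable f 0 df isof isT.
have i1 := isotropic_integrable f 1 df isof isT.
under eq_integral => x _.
  (* The powers [x ^+ 1] and [x ^+ 0] are kept to match [isotropic_integrable]. *)
  rewrite (_ : ((x - c) * f x)%:E =
    (x ^+ 1 * f x)%:E + (- c)%:E * (x ^+ 0 * f x)%:E); last first.
    by rewrite -EFinM -EFinD; congr EFin; ring.
  over.
rewrite integralD//; last exact: integrableZl.
rewrite integralZl//.
under eq_integral do rewrite expr1.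
under [X in _ + _ * X]eq_integral do rewrite mul1r.
by rewrite m1 f1 add0e mule1.
Qed.

Lemma isotropic_second_moment {R : realType} (f : R -> R) (c : R) :
  prob_density f -> isotropic_density f ->
  \int[lebesgue_measure]_x ((x - c) ^+ 2 * f x)%:E = (1 + c ^+ 2)%:E.
Proof.
move=> df isof; have [mf [f0 f1]] := df; have [m1 m2] := isof.
have i0 := isotropic_integrable f 0 df isof isT.
have i1 := isotropic_integrable f 1 df isof isT.
have i2 := isotropic_integrable f 2 df isof isT.
under eq_integral => x _.
  rewrite (_ : ((x - c) ^+ 2 * f x)%:E = (x ^+ 2 * f x)%:E +
    ((- 2 * c)%:E * (x ^+ 1 * f x)%:E + (c ^+ 2)%:E * (x ^+ 0 * f x)%:E)).
    over.
  by rewrite -!EFinM -!EFinD; congr EFin; ring.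
rewrite integralD//; last by apply: integrableD => //; exact: integrableZl.
rewrite integralD//; [|exact: integrableZl..].
rewrite !integralZl//.
under [X in _ + (_ * X + _)]eq_integral do rewrite expr1.
under [X in _ + (_ + _ * X)]eq_integral do rewrite mul1r.
by rewrite m1 f1 m2 mule0 add0e mule1 EFinD.
Qed.

(** The moments of orders 0, 1, 2 of [f] to the right of [c] ([h]) and to its left ([k]) play the
    roles of [p, A, E] and [q, B, F] in [variance_density_bound]. *)
Lemma isotropic_log_concave_le1 {R : realType} (f : R -> R) (c : R) :
  log_concave_density f -> isotropic_density f -> (f c <= 1)%R.
Proof.
move=> lcf isof; have [df lc] := lcf; have [mf [f0 f1]] := df.
have := f0 c; rewrite le_eqVlt => /predU1P[<-//|M0].
pose h x := f (c + x)%R; pose k x := f (c - x)%R.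
have mh : measurable_fun [set: R] h.
  by apply: measurableT_comp => //; exact: measurable_funD.
have mk : measurable_fun [set: R] k.
  by apply: measurableT_comp => //; exact: measurable_funB.
have h0 x : (0 <= h x)%R by exact: f0.
have k0 x : (0 <= k x)%R by exact: f0.
have hlc x y : (0 <= x -> 0 <= y -> h 0 * h (x + y) <= h x * h y)%R.
  move=> x0 y0; rewrite /h addr0.
  by have := @log_concave_half_line _ f c 1 x y f0 lc x0 y0; rewrite !mul1r.
have klc x y : (0 <= x -> 0 <= y -> k 0 * k (x + y) <= k x * k y)%R.
  move=> x0 y0; rewrite /k subr0.
  by have := @log_concave_half_line _ f c (-1) x y f0 lc x0 y0; rewrite !mulN1r.
have hn n := half_moment_ge0 h n h0.
have kn n := half_moment_ge0 k n k0.
have mf' : measurable_fun [set: R] (EFin \o f) by exact/measurable_EFinP.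
have E0 : half_moment h 0 + half_moment k 0 = 1.
  by rewrite !half_moment0 -f1 (@ge0_integral_split_at _ c (EFin \o f)).
have mXc : measurable_fun [set: R] (fun x => x - c)%R by exact: measurable_funB.
have E2 : half_moment h 2 + half_moment k 2 = (1 + c ^+ 2)%:E.
  rewrite -(isotropic_second_moment f c)//.
  rewrite (@ge0_integral_split_at _ c)//; last 2 first.
  - by apply/measurable_EFinP/measurable_funM => //; exact: measurable_funX.
  - by move=> x; rewrite lee_fin mulr_ge0// sqr_ge0.
  congr (_ + _); apply: eq_integral => x _; congr EFin; rewrite /h /k; congr (_ * _)%R; ring.
have mxf : measurable_fun [set: R] (fun x => ((x - c) * f x)%:E).
  exact/measurable_EFinP/measurable_funM.
have E1 : half_moment h 1 - half_moment k 1 = (- c)%:E.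
  rewrite -(isotropic_first_moment f c)// integralE.
  have x_ge0 (x : R) : x \in `[0%R, +oo[%classic -> (0 <= x)%R.
    by rewrite mem_setE in_itv/= andbT.
  (* The positive part of [(x - c) * f x] lives on the right of [c] and the negative part on the
     left. *)
  congr (_ - _).
    rewrite (@ge0_integral_split_at _ c)//; last exact: measurable_funepos.
    rewrite [X in _ = _ + X]integral0_eq ?adde0; last first.
      move=> x /mem_set/x_ge0 x0; rewrite funeposE; apply/max_idPr.
      rewrite lee_fin addrAC subrr add0r mulNr oppr_le0; exact: mulr_ge0.
    apply: eq_integral => x /x_ge0 x0; rewrite funeposE addrAC subrr add0r expr1.
    by apply/esym/max_idPl; rewrite lee_fin; exact: mulr_ge0.
  rewrite (@ge0_integral_split_at _ c)//; last exact: measurable_funeneg.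
  rewrite [X in _ = X + _]integral0_eq ?add0e; last first.
    move=> x /mem_set/x_ge0 x0; rewrite funenegE; apply/max_idPr.
    rewrite -EFinN lee_fin addrAC subrr add0r oppr_le0; exact: mulr_ge0.
  apply: eq_integral => x /x_ge0 x0; rewrite funenegE addrAC subrr add0r expr1.
  rewrite -EFinN mulNr opprK.
  by apply/esym/max_idPl; rewrite lee_fin; exact: mulr_ge0.
have fin_l (u v : \bar R) r : 0 <= u -> 0 <= v -> u + v = r%:E -> u \is a fin_num.
  move=> u0 v0 uv; rewrite ge0_fin_numE//.
  by apply: (@le_lt_trans _ _ (u + v)); rewrite ?leeDl// uv ltry.
have fin_r (u v : \bar R) r : 0 <= u -> 0 <= v -> u + v = r%:E -> v \is a fin_num.
  by move=> u0 v0; rewrite addeC; exact: fin_l.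
have hf0 : half_moment h 0 \is a fin_num by apply: fin_l E0.
have kf0 : half_moment k 0 \is a fin_num by apply: fin_r E0.
have hf2 : half_moment h 2 \is a fin_num by apply: fin_l E2.
have kf2 : half_moment k 2 \is a fin_num by apply: fin_r E2.
have I1h := half_moment_succ_le h 0 mh h0 hlc.
have I1k := half_moment_succ_le k 0 mk k0 klc.
have I2h := half_moment_succ_le h 1 mh h0 hlc.
have I2k := half_moment_succ_le k 1 mk k0 klc.
(* Finiteness of the first moments comes from the moment inequality itself, because [f c > 0] and
   the masses are finite. *)
have fin_mul (u : \bar R) (v : R) : 0 <= u -> (f c)%:E * u <= v%:E -> u \is a fin_num.
  move=> u0; rewrite ge0_fin_numE//; case: u u0 => // [r _ _|_]; first exact: ltry.
  by rewrite gt0_muley ?lte_fin// leye_eq.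
have hE : h 0%R = f c by rewrite /h addr0.
have kE : k 0%R = f c by rewrite /k subr0.
move: I1h I1k I2h I2k; rewrite hE kE.
move: E0 E1 E2 (hn 0%N) (kn 0%N) (hn 1%N) (kn 1%N).
move: hf0 kf0 hf2 kf2.
move: (half_moment h 0) (half_moment h 1) (half_moment h 2) => p A E.
move: (half_moment k 0) (half_moment k 1) (half_moment k 2) => q B F.
case: p => // p _; case: q => // q _; case: E => // E _; case: F => // F _.
move=> E0 E1 E2 p0 q0 A0 B0 I1h I1k.
(* The factor 1 is the [n.+1] of the moment inequality at [n = 0]. *)
have Af : A \is a fin_num by apply: (fin_mul _ (1 * (p * p))%R).
have Bf : B \is a fin_num by apply: (fin_mul _ (1 * (q * q))%R).
move: A B A0 B0 Af Bf E1 I1h I1k => [A||]// [B||]// A0 B0 _ _ [E1].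
rewrite !lee_fin !mul1r => I1h I1k I2h I2k.
case: E0 => E0; case: E2 => E2.
exact: (@variance_density_bound _ (f c) p q A B E F c).
Qed.

(** * Boundary measure through the two outer strips *)

Lemma mu_of_enlarge {R : realType} (f : R -> R) (a b e : R) :
  prob_density f -> (a < b)%R -> (0 < e)%R ->
  mu_of f `[(a - e)%R, (b + e)%R]%classic - mu_of f `[a, b]%classic =
  mu_of f `[(a - e)%R, a[%classic + mu_of f `]b, (b + e)%R]%classic.
Proof.
move=> [mf [f0 f1]] ab e0; rewrite /mu_of.
have mF (D : set R) : measurable_fun D (EFin \o f).
  exact/measurable_EFinP/measurable_funTS.
have -> : `[(a - e)%R, (b + e)%R]%classic =
    `[(a - e)%R, a[%classic `|` `]b, (b + e)%R]%classic `|` `[a, b]%classic.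
  apply/seteqP; split=> x /=; rewrite !in_itv/=.
    move=> /andP[x1 x2]; case: (ltP x a) => xa; first by left; left; rewrite x1.
    by case: (leP x b) => xb; [right|left; right].
  by move=> [[]|] /andP[? ?]; apply/andP; split; clear f1; lra.
rewrite ge0_integral_setU//=; first last.
- apply/disj_setPS => x /=; rewrite !in_itv/= => -[[/andP[? ?]|/andP[? ?]] /andP[? ?]]; clear f1; lra.
- by move=> x _; rewrite lee_fin.
- exact: mF.
- exact: measurableU.
(* Cancellation in the extended reals requires the mass of [[a, b]] to be finite; it is at most
   1. *)
rewrite addeK; last first.
  rewrite ge0_fin_numE; last by apply: integral_ge0 => x _; rewrite lee_fin.
  apply: (@le_lt_trans _ _ 1); last exact: ltry.
  rewrite -f1; apply: ge0_subset_integral => //; first exact: mF.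
  by move=> x _; rewrite lee_fin.
rewrite ge0_integral_setU//=.
- exact: mF.
- by move=> x _; rewrite lee_fin.
- apply/disj_setPS => x /=; rewrite !in_itv/= => -[/andP[? ?] /andP[? ?]]; clear f1; lra.
Qed.

Lemma mu_of_le {R : realType} (f : R -> R) (D : set R) (K : R) :
  prob_density f -> measurable D -> (forall x, D x -> f x <= K)%R ->
  mu_of f D <= K%:E * lebesgue_measure D.
Proof.
move=> [mf [f0 f1]] mD fK; rewrite -integral_cst//.
apply: ge0_le_integral => //.
- by move=> x _; rewrite lee_fin.
- exact/measurable_EFinP/measurable_funTS.
Qed.

Lemma mu_of_ge {R : realType} (f : R -> R) (D : set R) (K : R) :
  prob_density f -> measurable D -> (0 <= K)%R ->
  (forall x, D x -> K <= f x)%R ->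
  K%:E * lebesgue_measure D <= mu_of f D.
Proof.
move=> [mf [f0 f1]] mD K0 fK; rewrite -integral_cst//.
apply: ge0_le_integral => //.
exact/measurable_EFinP/measurable_funTS.
Qed.

Lemma boundary_measure_le {R : realType} (f : R -> R) (a b : R) :
  prob_density f -> (forall x, f x <= 1)%R -> (a < b)%R ->
  boundary_measure f a b <= 2%:E.
Proof.
move=> df fle ab; rewrite /boundary_measure limf_einfE.
apply: ge_ereal_sup => _ [V V0 <-].
(* The lower limit is a supremum over [V] of infima, and each infimum is at most the quotient at a
   single positive [e] in [V]. *)
have [e [e0 Ve]] : exists e : R, (0 < e)%R /\ V e.
  apply: (@filter_ex _ (0%R : R)^'+).
  by apply: filterI => //; exact: nbhs_right_gt.
apply: le_trans (ereal_inf_lbound _) _; first by exists e.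
rewrite mu_of_enlarge// lee_pdivrMr//.
have -> : 2%:E * e%:E = 1%:E * e%:E + 1%:E * e%:E :> \bar R.
  by rewrite -!EFinM -EFinD; congr EFin; ring.
have la : lebesgue_measure `[(a - e)%R, a[%classic = e%:E :> \bar R.
  rewrite lebesgue_measure_itv/= lte_fin ifT; last lra.
  by rewrite -EFinD; congr EFin; ring.
have lb : lebesgue_measure `]b, (b + e)%R]%classic = e%:E :> \bar R.
  rewrite lebesgue_measure_itv/= lte_fin ifT; last lra.
  by rewrite -EFinD; congr EFin; ring.
by apply: leeD; [rewrite -la|rewrite -lb]; apply: mu_of_le.
Qed.

(** For [0 < e < d] both strips lie in [[a - d, b + d]], so each has mass at least [K * e]; the
    neighbourhood []0, d[] then bounds the lower limit from below. *)
Lemma boundary_measure_ge {R : realType} (f : R -> R) (a b d K : R) :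
  prob_density f -> (a < b)%R -> (0 < d)%R -> (0 <= K)%R ->
  (forall x, a - d <= x <= b + d -> K <= f x)%R ->
  (2 * K)%:E <= boundary_measure f a b.
Proof.
move=> df ab d0 K0 fK; rewrite /boundary_measure limf_einfE.
apply: le_ereal_sup_tmp; eexists.
  exists [set e : R | (0 < e < d)%R]; last by [].
  near=> e; rewrite /=; apply/andP; split; near: e; [exact: nbhs_right_gt|exact: nbhs_right_lt].
apply: le_ereal_inf_tmp => _ [e /= /andP[e0 ed] <-].
rewrite mu_of_enlarge// lee_pdivlMr//.
have -> : (2 * K)%:E * e%:E = K%:E * e%:E + K%:E * e%:E :> \bar R.
  by rewrite -!EFinM -EFinD; congr EFin; ring.
have la : lebesgue_measure `[(a - e)%R, a[%classic = e%:E :> \bar R.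
  rewrite lebesgue_measure_itv/= lte_fin ifT; last lra.
  by rewrite -EFinD; congr EFin; ring.
have lb : lebesgue_measure `]b, (b + e)%R]%classic = e%:E :> \bar R.
  rewrite lebesgue_measure_itv/= lte_fin ifT; last lra.
  by rewrite -EFinD; congr EFin; ring.
apply: leeD; [rewrite -la|rewrite -lb]; apply: mu_of_ge => // x /=.
  by rewrite in_itv/= => /andP[? ?]; apply: fK; apply/andP; split; lra.
by rewrite in_itv/= => /andP[? ?]; apply: fK; apply/andP; split; lra.
Unshelve. all: by end_near.
Qed.

Lemma Gamma_le2 {R : realType} (f : R -> R) :
  log_concave_density f -> isotropic_density f -> Gamma f <= 2%:E.
Proof.
move=> lcf isof; apply: ge_ereal_sup => _ [[a b] /= ab <-].
apply: boundary_measure_le => //; first by case: lcf.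
by move=> x; exact: isotropic_log_concave_le1.
Qed.

(** * The shifted exponential law *)

Lemma shifted_exp_density_ge0 {R : realType} (x : R) :
  (0 <= shifted_exp_density x)%R.
Proof. by rewrite /shifted_exp_density; case: ifP => // _; exact: expR_ge0. Qed.

Lemma measurable_shifted_exp_density {R : realType} :
  measurable_fun [set: R] (@shifted_exp_density R).
Proof.
apply: measurable_fun_ifT => //; first exact: measurable_fun_ler.
apply: measurableT_comp => //; apply: measurableT_comp => //.
exact: measurable_funD.
Qed.

(** Translation by -1 turns moments about -1 into moments of the exponential law, which the
    recurrence computes. *)
Lemma shifted_exp_moment {R : realType} (n : nat) :
  \int[lebesgue_measure]_x ((x + 1) ^+ n * shifted_exp_density x)%:E =
  half_moment (fun x : R => expR (- x)) n.
Proof.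
have msed := @measurable_shifted_exp_density R.
rewrite (@ge0_integral_shift _ (-1)%R)//; last 2 first.
- apply/measurable_EFinP/measurable_funM => //.
  by apply: measurable_funX; exact: measurable_funD.
- move=> x; rewrite lee_fin /shifted_exp_density; case: ifPn => x1.
    by rewrite mulr_ge0 ?expR_ge0// exprn_ge0//; lra.
  by rewrite mulr0.
rewrite preimage_setT /half_moment [RHS]integral_mkcond.
apply: eq_integral => x _.
rewrite patchE mem_setE in_itv/= andbT /shifted_exp_density.
rewrite addrAC addNr add0r lerDl; case: ifP => // _.
by rewrite mulr0.
Qed.

Lemma shifted_exp_moments {R : realType} (f := @shifted_exp_density R) :
  [/\ \int[lebesgue_measure]_x ((x + 1) ^+ 0 * f x)%:E = 1,
      \int[lebesgue_measure]_x ((x + 1) ^+ 1 * f x)%:E = 1 &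
      \int[lebesgue_measure]_x ((x + 1) ^+ 2 * f x)%:E = 2%:E].
Proof.
rewrite !shifted_exp_moment !half_moment_expRN_succ half_moment_expRN0.
by rewrite !mule1.
Qed.

Lemma shifted_exp_prob_density {R : realType} :
  prob_density (@shifted_exp_density R).
Proof.
split; [exact: measurable_shifted_exp_density|split].
  exact: shifted_exp_density_ge0.
have [<- _ _] := @shifted_exp_moments R.
by apply: eq_integral => x _; rewrite expr0 mul1r.
Qed.

Lemma shifted_exp_isotropic {R : realType} :
  isotropic_density (@shifted_exp_density R).
Proof.
pose f := @shifted_exp_density R.
have [m0 m1 m2] := @shifted_exp_moments R.
(* The integrand is nonnegative, as the density vanishes where [x + 1 < 0], so a finite integral
   gives integrability. *)
have mi n : \int[lebesgue_measure]_x ((x + 1) ^+ n * f x)%:E < +oo ->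
    lebesgue_measure.-integrable [set: R] (fun x => ((x + 1) ^+ n * f x)%:E).
  move=> h; apply/integrableP; split.
    apply/measurable_EFinP/measurable_funM; last exact: measurable_shifted_exp_density.
    by apply: measurable_funX; exact: measurable_funD.
  under eq_integral => x _.
    rewrite gee0_abs; last first.
      rewrite lee_fin /f /shifted_exp_density; case: ifPn => x1; last by rewrite mulr0.
      by rewrite mulr_ge0 ?expR_ge0// exprn_ge0//; lra.
    over.
  exact: h.
have i0 := mi 0%N; have i1 := mi 1%N; have i2 := mi 2%N.
rewrite m0 ltry in i0; rewrite m1 ltry in i1; rewrite m2 ltry in i2.
move: i0 i1 i2 => /(_ isT) i0 /(_ isT) i1 /(_ isT) i2.
split.
  (* Mean: [x = (x + 1) - 1] gives [1 - 1 = 0]. *)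
  under eq_integral => x _.
    rewrite (_ : (x * shifted_exp_density x)%:E =
      ((x + 1) ^+ 1 * f x)%:E + (-1)%:E * ((x + 1) ^+ 0 * f x)%:E); last first.
      by rewrite -EFinM -EFinD; congr EFin; rewrite /f; ring.
    over.
  rewrite integralD//; last exact: integrableZl.
  by rewrite integralZl// m0 m1 mule1 -EFinD subrr.
(* Second moment: [x^2 = (x + 1)^2 - 2 (x + 1) + 1] gives [2 - 2 + 1 = 1]. *)
under eq_integral => x _.
  rewrite (_ : (x ^+ 2 * shifted_exp_density x)%:E = ((x + 1) ^+ 2 * f x)%:E +
    ((-2)%:E * ((x + 1) ^+ 1 * f x)%:E + ((x + 1) ^+ 0 * f x)%:E)); last first.
    by rewrite -EFinM -!EFinD; congr EFin; rewrite /f; ring.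
  over.
rewrite integralD//; last by apply: integrableD => //; exact: integrableZl.
rewrite integralD//; last exact: integrableZl.
by rewrite integralZl// m0 m1 m2 mule1 -!EFinD; congr EFin; ring.
Qed.

Lemma lnE_shifted_exp {R : realType} (x : R) :
  lnE (@shifted_exp_density R) x = if (-1 <= x)%R then (- (x + 1))%:E else -oo.
Proof.
rewrite /lnE /shifted_exp_density.
case: (-1 <= x)%R; last by rewrite ltxx.
by rewrite expR_gt0 expRK.
Qed.

(** The logarithm is affine on the convex set [[-1, +oo[], where equality holds, and [-oo]
    elsewhere. *)
Lemma shifted_exp_log_concave {R : realType} :
  log_concave_fun (@shifted_exp_density R).
Proof.
move=> x y t /andP[t0 t1]; rewrite !lnE_shifted_exp.
have t1' : (0 < 1 - t)%R by lra.
case: ifPn => x1; last by rewrite gt0_muleNy ?lte_fin// addNye leNye.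
case: ifPn => y1; last by rewrite [_ * -oo]gt0_muleNy ?lte_fin// addeNy leNye.
rewrite ifT; last by nra.
by rewrite -!EFinM -EFinD lee_fin le_eqVlt; apply/orP; left; apply/eqP; ring.
Qed.

Lemma Gamma_shifted_exp_ge2 {R : realType} :
  2%:E <= Gamma (@shifted_exp_density R).
Proof.
apply/lee_addgt0Pr => e e0.
(* The interval [[-1 + d, -1 + 2d]] enlarged by [d] is [[-1, -1 + 3d]], where the density is at
   least [expR (- (3 * d)) >= 1 - 3d]; twice this is at least [2 - 6d = 2 - e]. *)
pose d := (e / 6)%R.
have d0 : (0 < d)%R by rewrite divr_gt0.
have eE : e = (6 * d)%R by rewrite /d; field.
rewrite -leeBlDr//.
apply: le_ereal_sup_tmp.
exists (boundary_measure (@shifted_exp_density R) (-1 + d) (-1 + 2 * d)).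
  by exists (-1 + d, -1 + 2 * d)%R => //=; lra.
apply: (@le_trans _ _ (2 * expR (- (3 * d)))%:E).
  by rewrite -EFinB lee_fin; have := expR_ge1Dx (- (3 * d))%R; lra.
apply: (@boundary_measure_ge _ _ _ _ d) => //.
- exact: shifted_exp_prob_density.
- by lra.
move=> x /andP[x1 x2]; rewrite /shifted_exp_density ifT; last by lra.
by rewrite ler_expR; lra.
Qed.

Theorem theorem5p9 (R : realType) :
  (forall f : R -> R, log_concave_density f -> isotropic_density f ->
     Gamma f <= 2%:E) /\
  (log_concave_density (@shifted_exp_density R) /\
   isotropic_density (@shifted_exp_density R) /\
   Gamma (@shifted_exp_density R) = 2%:E).
Proof.
have lcd : log_concave_density (@shifted_exp_density R).
  by split; [exact: shifted_exp_prob_density|exact: shifted_exp_log_concave].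
have isod := @shifted_exp_isotropic R.
split; first by move=> f; exact: Gamma_le2.
do 2 split => //.
apply/le_anti/andP; split; [exact: Gamma_le2|exact: Gamma_shifted_exp_ge2].
Qed.
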